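(* Let $a_0,a_1,a_2,a_3\in\mathbb H$ be affinely independent over $\mathbb R$. Set $p_0=0$ and $p_j=a_j-a_0$ for $j=1,2,3$, and let $V$, $n$, $G$, $b(Q)$, $W(Q)$ and $\Delta_A$ be defined from $p_1,p_2,p_3$ as in the context. There exists a nonconstant entire slice regular function $f:\mathbb H\to\mathbb H$ omitting $a_0,a_1,a_2,a_3$ if and only if there exist real-symmetric zero-free entire functions $Q_0,Q_1,Q_2,Q_3:\mathbb C\to\mathbb C$ and a real-symmetric entire function $\tau:\mathbb C\to\mathbb C$ such that \[ \Delta_A(Q_0,Q_1,Q_2,Q_3)=\tau^2, \] and the stem function $F=W(Q)+\tau n$ is nonconstant.
   Context: $\mathbb H$ is the real quaternion algebra with basis $e_0=1,e_1=\mathbf i,e_2=\mathbf j,e_3=\mathbf k$, identified with Euclidean $\mathbb R^4$. $\mathbb H_{\mathbb C}=\mathbb H\otimes_{\mathbb R}\mathbb C$, with scalar imaginary unit $\mathrm i\in\mathbb C$; $\langle\cdot,\cdot\rangle$ is the complex-bilinear extension to $\mathbb H_{\mathbb C}$ of the Euclidean inner product of $\mathbb H$; $\sigma(\sum_\ell z_\ell e_\ell)=\sum_\ell\overline{z_\ell}e_\ell$. A real-symmetric entire stem function is an entire holomorphic map $F:\mathbb C\to\mathbb H_{\mathbb C}$ with $F(\overline z)=\sigma(F(z))$; write $F=F_1+\mathrm iF_2$ with $F_1,F_2$ $\mathbb H$-valued. With $\mathbb S=\{J\in\mathbb H:J^2=-1\}$, $F$ induces $f:\mathbb H\to\mathbb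 H$, $f(x+yJ)=F_1(x+\mathrm iy)+JF_2(x+\mathrm iy)$ ($x,y\in\mathbb R$, $J\in\mathbb S$); the entire slice regular functions are exactly the functions so induced, each by a unique real-symmetric entire stem function. An entire function $h:\mathbb C\to\mathbb C$ is real-symmetric if $h(\overline z)=\overline{h(z)}$. Let $p_1,p_2,p_3\in\mathbb H$ be real-linearly independent and $p_0=0$. $V=\operatorname{span}_{\mathbb R}\{p_1,p_2,p_3\}$; $n\in V^\perp\subset\mathbb H$ is a fixed unit vector; $G=(\langle p_i,p_j\rangle)_{1\le i,j\le3}$ is the Gram matrix (positive definite). For $Q=(Q_0,Q_1,Q_2,Q_3)$ put $b_j(Q)=\frac12(Q_0+\|p_j\|^2-Q_j)$ for $j=1,2,3$, $b(Q)=(b_1(Q),b_2(Q),b_3(Q))^T$, $W(Q)=\sum_{i,k=1}^3(G^{-1})_{ik}b_k(Q)p_i$, and $\Delta_A(Q_0,Q_1,Q_2,Q_3)=Q_0-b(Q)^TG^{-1}b(Q)$ (the four-point discriminant). *)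

(* Defs.v *)
From HB Require Import structures.
From mathcomp Require Import all_boot all_order all_algebra.
From mathcomp Require Import complex.
From mathcomp Require Import all_classical all_reals all_analysis.

Set Implicit Arguments.
Unset Strict Implicit.
Unset Printing Implicit Defensive.

Import Order.TTheory GRing.Theory Num.Theory.
Import numFieldNormedType.Exports.

Local Open Scope ring_scope.
Local Open Scope complex_scope.

Definition nonconstant (X Y : Type) (f : X -> Y) : Prop :=
  exists x y, f x <> f y.

Section Quaternions.
Variable R : realType.

(* The quaternions are the row vectors of R^4 in the basis 1, i, j, k. *)
Definition quat : Type := 'rV[R]_4.

Definition qone : quat := delta_mx 0 0.

Definition qmul (u v : quat) : quat :=
  \row_(l < 4) nth 0
    [:: u 0 0 * v 0 0 - u 0 1 * v 0 1 - u 0 2 * v 0 2 - u 0 3 * v 0 3;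
        u 0 0 * v 0 1 + u 0 1 * v 0 0 + u 0 2 * v 0 3 - u 0 3 * v 0 2;
        u 0 0 * v 0 2 - u 0 1 * v 0 3 + u 0 2 * v 0 0 + u 0 3 * v 0 1;
        u 0 0 * v 0 3 + u 0 1 * v 0 2 - u 0 2 * v 0 1 + u 0 3 * v 0 0] l.

Definition qdot (u v : quat) : R := \sum_(l < 4) u 0 l * v 0 l.

Definition imag_unit (J : quat) : Prop := qmul J J = - qone.

Definition affinely_independent (m : nat) (a : 'I_m -> quat) : Prop :=
  forall c : 'I_m -> R,
    \sum_i c i = 0 -> \sum_i c i *: a i = 0 -> forall i, c i = 0.

End Quaternions.

Section EntireFunctions.
Variable R : realType.

(* The complexified quaternions are the row vectors of C^4 in the same basis. *)
Definition cquat : Type := 'rV[R[i]]_4.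

Definition cquat_of (u : quat R) : cquat := map_mx (real_complex R) u.
Definition cqconj (u : cquat) : cquat := map_mx (@conjc R) u.
Definition cqRe (u : cquat) : quat R := map_mx (@complex.Re R) u.
Definition cqIm (u : cquat) : quat R := map_mx (@complex.Im R) u.

(* The scalar field of the normed module R[i]^o is R[i], so that [derivable]
   in the direction 1 is complex differentiability. *)
Definition entire (h : R[i] -> R[i]) : Prop :=
  forall z : R[i]^o, derivable (h : R[i]^o -> R[i]^o) z 1.

Definition real_symmetric (h : R[i] -> R[i]) : Prop :=
  forall z, h (conjc z) = conjc (h z).

Definition zero_free (h : R[i] -> R[i]) : Prop := forall z, h z <> 0.

Definition cquat_entire (F : R[i] -> cquat) : Prop :=
  forall z : R[i]^o, derivable (F : R[i]^o -> 'rV[R[i]]_4) z 1.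

Definition real_symmetric_entire_stem (F : R[i] -> cquat) : Prop :=
  cquat_entire F /\ forall z, F (conjc z) = cqconj (F z).

Definition induces (F : R[i] -> cquat) (f : quat R -> quat R) : Prop :=
  forall (x y : R) (J : quat R), imag_unit J ->
    f (x *: qone R + y *: J) = cqRe (F (x +i* y)) + qmul J (cqIm (F (x +i* y))).

Definition entire_slice_regular (f : quat R -> quat R) : Prop :=
  exists2 F, real_symmetric_entire_stem F & induces F f.

End EntireFunctions.

Section FourPoints.
Variables (R : realType) (p : 'I_3 -> quat R).

Definition span_mx : 'M[R]_(3, 4) := \matrix_(i < 3) (p i : 'rV[R]_4).

Definition unit_normal (n : quat R) : Prop :=
  qdot n n = 1 /\
  forall v : 'rV[R]_4, (v <= span_mx)%MS -> qdot n v = 0.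

Definition gram : 'M[R]_3 := \matrix_(i, j) qdot (p i) (p j).

(* Below, p i stands for p_(i+1) and q = (q_0, ..., q_3) is a point of C^4;
   lift ord0 i is the index i+1. *)
Definition bvec (q : 'I_4 -> R[i]) : 'cV[R[i]]_3 :=
  \col_(i < 3) (2^-1 * (q ord0 + (qdot (p i) (p i))%:C - q (lift ord0 i))).

Definition Wvec (q : 'I_4 -> R[i]) : cquat R :=
  \sum_(i < 3) \sum_(k < 3)
    (((invmx gram) i k)%:C * bvec q k 0) *: cquat_of (p i).

Definition DeltaA (q : 'I_4 -> R[i]) : R[i] :=
  q ord0 -
  ((bvec q)^T *m map_mx (real_complex R) (invmx gram) *m bvec q) 0 0.

End FourPoints.

(* Main.v *)
(** A stem value [w = u + i v] satisfies [<w, w> = |u|^2 - |v|^2 + 2 i <u, v>],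
    and this vanishes exactly when [u + J v = 0] for some imaginary unit [J]
    (take [J = - u v^-1] if [v <> 0]). Hence [f] omits [c] if and only if
    [<F - c, F - c>] is zero-free.
    For [w = F - a_0] put [Q_0 = <w, w>] and [Q_j = <w - p_j, w - p_j>]; then
    [b_j(Q) = <w, p_j>], so [W(Q)] is the component of [w] in the complexified
    span of the [p_j], and [w = W(Q) + <w, n> n] with
    [Q_0 = b^T G^-1 b + <w, n>^2], i.e. [Delta_A(Q) = tau^2] for [tau = <w, n>].
    Conversely [W(Q) + tau n] has exactly these products with itself and the
    [p_j]. The matrix form of the decomposition is [P^T G^-1 P + n^T n = 1],
    where [P] has rows [p_j]; it holds because the square matrix with rows
    [p_j] and [n] has [[P^T G^-1, n^T]] as a right inverse. *)
Require Import Defs.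
From HB Require Import structures.
From mathcomp Require Import all_boot all_order all_algebra.
From mathcomp Require Import complex.
From mathcomp Require Import all_classical all_reals all_analysis.
From mathcomp Require Import ring lra.

Import Order.TTheory GRing.Theory Num.Theory.
Import numFieldNormedType.Exports.

Local Open Scope ring_scope.
Local Open Scope complex_scope.

(** * Coordinates in dimension four *)

Lemma sum_ord4 {V : nmodType} (f : 'I_4 -> V) :
  \sum_(l < 4) f l = f 0 + f 1 + f 2 + f 3.
Proof.
rewrite !big_ord_recl big_ord0 addr0 !addrA.
by congr (f _ + f _ + f _ + f _); apply: val_inj.
Qed.

Lemma row4P {T : Type} (u v : 'rV[T]_4) :
  u 0 0 = v 0 0 -> u 0 1 = v 0 1 -> u 0 2 = v 0 2 -> u 0 3 = v 0 3 -> u = v.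
Proof.
move=> e0 e1 e2 e3; apply/rowP => -[[|[|[|[|//]]]] lt_l].
- by rewrite (_ : Ordinal lt_l = 0) //; apply: val_inj.
- by rewrite (_ : Ordinal lt_l = 1) //; apply: val_inj.
- by rewrite (_ : Ordinal lt_l = 2) //; apply: val_inj.
- by rewrite (_ : Ordinal lt_l = 3) //; apply: val_inj.
Qed.

(** * Quaternion algebra, imaginary units and polar form *)

Section QuaternionAlgebra.
Context {R : realType}.
Implicit Types u v w q J : quat R.

Definition qconj u : quat R := (2 * u 0 0) *: qone R - u.

Lemma qdotE u v :
  qdot u v = u 0 0 * v 0 0 + u 0 1 * v 0 1 + u 0 2 * v 0 2 + u 0 3 * v 0 3.
Proof. exact: sum_ord4. Qed.

Lemma qdot_eq0 {u} : qdot u u = 0 -> u = 0.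
Proof. by rewrite qdotE => uu; apply: row4P; rewrite [RHS]mxE; nra. Qed.

Lemma qdotZZ c u v : qdot (c *: u) (c *: v) = c ^+ 2 * qdot u v.
Proof. by rewrite !qdotE !mxE; ring. Qed.

Lemma qdotNN u v : qdot (- u) (- v) = qdot u v.
Proof. by rewrite !qdotE !mxE; ring. Qed.

Lemma qmulA u v w : qmul u (qmul v w) = qmul (qmul u v) w.
Proof. by apply: row4P; rewrite !mxE /=; ring. Qed.

Lemma qmulr0 u : qmul u 0 = 0.
Proof. by apply: row4P; rewrite !mxE /=; ring. Qed.

Lemma qmulr1 u : qmul u (qone R) = u.
Proof. by apply: row4P; rewrite !mxE /=; ring. Qed.

Lemma qmulNl u v : qmul (- u) v = - qmul u v.
Proof. by apply: row4P; rewrite !mxE /=; ring. Qed.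

Lemma qmulrN u v : qmul u (- v) = - qmul u v.
Proof. by apply: row4P; rewrite !mxE /=; ring. Qed.

Lemma qmulZl c u v : qmul (c *: u) v = c *: qmul u v.
Proof. by apply: row4P; rewrite !mxE /=; ring. Qed.

Lemma qmulZr c u v : qmul u (c *: v) = c *: qmul u v.
Proof. by apply: row4P; rewrite !mxE /=; ring. Qed.

Lemma qmulVq u : qmul (qconj u) u = qdot u u *: qone R.
Proof. by rewrite qdotE; apply: row4P; rewrite !mxE /=; ring. Qed.

Lemma qdot_conj u : qdot (qconj u) (qconj u) = qdot u u.
Proof. by rewrite !qdotE !mxE /=; ring. Qed.

(** Euler's four-square identity, i.e. multiplicativity of the squared norm. *)
Lemma qdot_mul u v : qdot (qmul u v) (qmul u v) = qdot u u * qdot v v.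
Proof. by rewrite !qdotE !mxE /=; ring. Qed.

Lemma qmul_conj_re u v : qmul u (qconj v) 0 0 = qdot u v.
Proof. by rewrite qdotE !mxE /=; ring. Qed.

(** The components of [J^2] along i, j, k are [2 J_0 J_l]. If [J_0] were nonzero, all [J_l] would
    vanish and [J_0^2 = -1], which is impossible over the reals. *)
Lemma imag_unitP {J} : imag_unit J <-> J 0 0 = 0 /\ qdot J J = 1.
Proof.
rewrite qdotE; split=> [JJ|[J0 J1]].
  have JJ0 : (qmul J J) 0 0 = - 1 by rewrite JJ !mxE.
  have JJ1 : (qmul J J) 0 1 = 0 by rewrite JJ !mxE oppr0.
  have JJ2 : (qmul J J) 0 2 = 0 by rewrite JJ !mxE oppr0.
  have JJ3 : (qmul J J) 0 3 = 0 by rewrite JJ !mxE oppr0.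
  move: JJ0 JJ1 JJ2 JJ3; rewrite !mxE /= => JJ0 JJ1 JJ2 JJ3.
  suff J0 : J 0 0 = 0 by split=> //; move: JJ0; rewrite J0; lra.
  apply/eqP; apply: contraTT isT => J0; exfalso.
  have J1 : J 0 1 = 0 by apply: (mulfI J0); lra.
  have J2 : J 0 2 = 0 by apply: (mulfI J0); lra.
  have J3 : J 0 3 = 0 by apply: (mulfI J0); lra.
  by move: JJ0; rewrite J1 J2 J3; nra.
by rewrite J0 in J1; apply: row4P; rewrite !mxE /= J0; lra.
Qed.

Lemma imag_unitN {J} : imag_unit J -> imag_unit (- J).
Proof. by rewrite /imag_unit qmulNl qmulrN opprK. Qed.

Lemma imag_unit_exists : exists J, imag_unit J.
Proof.
exists (delta_mx 0 1); apply/imag_unitP.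
by rewrite qdotE !mxE /=; split=> //; ring.
Qed.

(** With [v] the imaginary part of [q], take [y = |v|] and [J = v / |v|]; for real [q], take [y = 0]
    and any [J]. *)
Lemma quat_polar q : exists x y J, imag_unit J /\ q = x *: qone R + y *: J.
Proof.
pose v := q - q 0 0 *: qone R.
have v0 : v 0 0 = 0 by rewrite !mxE /= mulr1 subrr.
have qE : q = q 0 0 *: qone R + v by rewrite addrC subrK.
have [vv|vv] := eqVneq (qdot v v) 0.
  have [J HJ] := imag_unit_exists.
  by exists (q 0 0), 0, J; split=> //; rewrite {1}qE (qdot_eq0 vv) scale0r.
have vv_gt0 : 0 < qdot v v.
  by rewrite lt_def vv qdotE; nra.
exists (q 0 0), (Num.sqrt (qdot v v)), ((Num.sqrt (qdot v v))^-1 *: v).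
have sqrt_neq0 : Num.sqrt (qdot v v) != 0 by rewrite sqrtr_eq0 -ltNge.
split; last by rewrite scalerA divff // scale1r.
apply/imag_unitP; rewrite !mxE /= mulr1 subrr mulr0; split=> //.
by rewrite qdotZZ exprVn sqr_sqrtr ?mulVf // ltW.
Qed.

(** Real parts give [x = x'] and squared norms give [y^2 = y'^2]. The only ambiguity is thus the
    sign of [(y, J)], or all of [J] when [y = 0]. *)
Lemma imag_unit_scaleI {x y x' y' : R} {J J'} : imag_unit J -> imag_unit J' ->
    x *: qone R + y *: J = x' *: qone R + y' *: J' ->
  [/\ x = x', y = y' \/ y = - y' & y *: J = y' *: J'].
Proof.
move=> /imag_unitP[J0 J1] /imag_unitP[J0' J1'] e.
have ex : x = x'.
  by move/(congr1 (fun q : quat R => q 0 0)): e; rewrite !mxE /= J0 J0'; lra.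
move: e; rewrite ex => /addrI e; split=> //.
have : y ^+ 2 = y' ^+ 2.
  have := congr1 (fun q => qdot q q) e.
  by rewrite !qdotZZ J1 J1' !mulr1.
by move/eqP; rewrite eqf_sqr => /orP[] /eqP; [left|right].
Qed.

End QuaternionAlgebra.

(** Bilinear with no conjugation, so over [R[i]] it has nonzero isotropic vectors. The ring is
    arbitrary so that the form serves both [R] and [R[i]]. *)
Definition cdot {K : pzRingType} (u v : 'rV[K]_4) : K :=
  \sum_(l < 4) u 0 l * v 0 l.

(** * Slice values, their zeros, and the passage between [F] and [f] *)

Section SliceValues.
Context {R : realType}.
Implicit Types (w : cquat R) (J c q : quat R) (F : R[i] -> cquat R).

Definition slice_value w J : quat R := cqRe w + qmul J (cqIm w).

Lemma slice_valueB w c J :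
  slice_value (w - cquat_of c) J = slice_value w J - c.
Proof.
rewrite /slice_value; have -> : cqIm (w - cquat_of c) = cqIm w.
  by apply/rowP => l; rewrite !mxE; case: (w 0 l) => x y /=; rewrite oppr0 addr0.
rewrite addrAC; congr (_ + _).
by apply/rowP => l; rewrite !mxE; case: (w 0 l).
Qed.

Lemma slice_value_conj w J : slice_value (cqconj w) J = slice_value w (- J).
Proof.
rewrite /slice_value qmulNl -qmulrN; congr (_ + qmul _ _).
  by apply/rowP => l; rewrite !mxE; case: (w 0 l).
by apply/rowP => l; rewrite !mxE; case: (w 0 l).
Qed.

Lemma cdot_self w :
  cdot w w = (qdot (cqRe w) (cqRe w) - qdot (cqIm w) (cqIm w))
             +i* (2 * qdot (cqRe w) (cqIm w)).
Proof.
rewrite /cdot !qdotE !sum_ord4 !mxE.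
case: (w 0 0) => x0 y0; case: (w 0 1) => x1 y1.
case: (w 0 2) => x2 y2; case: (w 0 3) => x3 y3.
by apply/eqP; rewrite eq_complex /=; apply/andP; split; apply/eqP; ring.
Qed.

Lemma cdot_self_eq0P w :
  cdot w w = 0 <-> exists2 J, imag_unit J & slice_value w J = 0.
Proof.
rewrite cdot_self /slice_value; set u := cqRe w; set v := cqIm w; split.
  case=> /eqP; rewrite subr_eq0 => /eqP uv2 uv.
  have {}uv : qdot u v = 0 by lra.
  have [vv|vv] := eqVneq (qdot v v) 0.
    have [J HJ] := @imag_unit_exists R; exists J => //.
    by rewrite (qdot_eq0 vv) qmulr0 addr0; apply: qdot_eq0; rewrite uv2.
  (* J = - u v^-1 *)
  exists (- (qdot v v)^-1 *: qmul u (qconj v)).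
    (* The real part is a multiple of [<u, v> = 0], and the squared norm is
       [|u|^2 |v|^2 / |v|^4 = 1] because [|u| = |v|]. *)
    apply/imag_unitP; rewrite mxE qmul_conj_re uv mulr0; split=> //.
    by rewrite qdotZZ qdot_mul qdot_conj uv2 sqrrN -expr2 -exprMn mulVf ?expr1n.
  rewrite qmulZl -qmulA qmulVq qmulZr qmulr1 scalerA mulNr mulVf //.
  by rewrite scaleN1r subrr.
(* Now [u = - J v], so [|u| = |v|] and [<u, v> = - J_0 |v|^2 = 0]. *)
case=> J /imag_unitP[J0 J1] /eqP; rewrite addr_eq0 => /eqP ->.
apply/eqP; rewrite eq_complex /=; apply/andP; split; apply/eqP.
  by rewrite qdotNN qdot_mul J1 mul1r subrr.
by rewrite !qdotE !mxE /= J0; ring.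
Qed.

(** Off the real axis a point fixes [(y, J)] up to a common sign, which the symmetry of [F] absorbs.
    On the real axis [F] is real, so [J] does not matter. *)
Lemma slice_value_indep {F} {x y x' y' : R} {J J'} :
    (forall z, F (conjc z) = cqconj (F z)) -> imag_unit J -> imag_unit J' ->
    x *: qone R + y *: J = x' *: qone R + y' *: J' ->
  slice_value (F (x +i* y)) J = slice_value (F (x' +i* y')) J'.
Proof.
move=> Fsym HJ HJ' /(imag_unit_scaleI HJ HJ')[-> yy' e].
have real_val K : slice_value (F (x' +i* 0)) K = cqRe (F (x' +i* 0)).
  have F_real : cqIm (F (x' +i* 0)) = 0.
    apply/rowP => l; have /rowP/(_ l) := Fsym (x' +i* 0).
    by rewrite /= oppr0 !mxE; case: (F _ 0 l) => s t [/=]; lra.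
  by rewrite /slice_value F_real qmulr0 addr0.
have [y'0|y'0] := eqVneq y' 0.
  by move: yy'; rewrite y'0 oppr0 => -[] ->; rewrite !real_val.
move/eqP: e; case: yy' => ->.
  by rewrite -subr_eq0 -scalerBr scaler_eq0 (negbTE y'0) subr_eq0 => /eqP ->.
rewrite scaleNr -scalerN -subr_eq0 -scalerBr scaler_eq0 (negbTE y'0) subr_eq0.
by move=> /eqP <-; rewrite -slice_value_conj -Fsym.
Qed.

(** The value at [q] is read off from a chosen polar form of [q]; [slice_value_indep] makes the
    choice immaterial. *)
Lemma induces_exists F :
  (forall z, F (conjc z) = cqconj (F z)) -> exists f, induces F f.
Proof.
move=> Fsym.
pose val_at q r := exists x y J,
  [/\ imag_unit J, q = x *: qone R + y *: J & r = slice_value (F (x +i* y)) J].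
have val_ex q : exists r, val_at q r.
  have [x [y [J [HJ ->]]]] := quat_polar q.
  by exists (slice_value (F (x +i* y)) J), x, y, J.
exists (fun q => sval (cid (val_ex q))) => x y J HJ.
case: cid => /= r [x' [y' [J' [HJ' e ->]]]].
by rewrite (slice_value_indep Fsym HJ' HJ (esym e)).
Qed.

Lemma induces_nonconstant {F f} : (forall z, F (conjc z) = cqconj (F z)) ->
  induces F f -> nonconstant f <-> nonconstant F.
Proof.
move=> Fsym Ff; split.
  case=> q [q' qq']; apply: contrapT => Fcst; apply: qq'.
  have F_eq z z' : F z = F z' by apply: contrapT => zz'; apply: Fcst; exists z, z'.
  have [x [y [J [HJ ->]]]] := quat_polar q.
  have [x' [y' [J' [HJ' ->]]]] := quat_polar q'.
  rewrite !Ff //; rewrite -!/(slice_value _ _).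
  (* Constancy of [F] moves both values to the same real point [x], where the imaginary unit is
     irrelevant. *)
  rewrite (F_eq (x +i* y) (x +i* 0)) (F_eq (x' +i* y') (x +i* 0)).
  by apply: slice_value_indep => //; rewrite !scale0r.
case=> z [z' zz']; apply: contrapT => fcst; apply: zz'.
have f_eq q q' : f q = f q' by apply: contrapT => qq'; apply: fcst; exists q, q'.
have [J HJ] := @imag_unit_exists R.
have FE w : (forall K, imag_unit K -> slice_value w K = f 0) ->
    cqRe w = f 0 /\ cqIm w = 0.
  move=> wK; have e1 := wK J HJ; have e2 := wK _ (imag_unitN HJ).
  rewrite /slice_value qmulNl in e2; rewrite /slice_value in e1.
  have e3 : qmul J (cqIm w) = 0.
    by apply/rowP => l; move/rowP/(_ l): e1; move/rowP/(_ l): e2; rewrite !mxE; lra.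
  split; first by rewrite -e1 e3 addr0.
  have [_ J1] := imag_unitP.1 HJ.
  by apply: qdot_eq0; rewrite -[LHS]mul1r -J1 -qdot_mul e3 qdotE !mxE; ring.
have FE' s : cqRe (F s) = f 0 /\ cqIm (F s) = 0.
  by case: s => x y; apply: FE => K HK; rewrite -(f_eq (x *: qone R + y *: K)) Ff.
apply/rowP => l; have [] := FE' z; have [] := FE' z'.
move=> /rowP/(_ l) + /rowP/(_ l) + /rowP/(_ l) + /rowP/(_ l); rewrite !mxE.
by case: (F z 0 l) => a b; case: (F z' 0 l) => c d /= -> -> -> ->.
Qed.

(** Subtracting a real quaternion from the stem subtracts it from every slice value, so
    [cdot_self_eq0P] applies to [F z - c]. *)
Lemma induces_omits {F f} c : induces F f ->
  (forall q, f q <> c) <->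
  (forall z, cdot (F z - cquat_of c) (F z - cquat_of c) <> 0).
Proof.
move=> Ff; split=> [fc [x y] /cdot_self_eq0P[J HJ]|Fc q].
  by rewrite slice_valueB -[slice_value _ _]Ff // => /eqP; rewrite subr_eq0 => /eqP /fc.
have [x [y [J [HJ ->]]]] := quat_polar q; rewrite Ff // => fc.
apply: (Fc (x +i* y)); apply/cdot_self_eq0P; exists J => //.
by rewrite slice_valueB /slice_value fc subrr.
Qed.

End SliceValues.

(* [derivable_mxP] of the library is restricted to real fields of scalars. *)
Lemma derivable_coordP {K : numFieldType} {V : normedModType K} {m n : nat}
    (M : V -> 'M[K]_(m, n)) (t v : V) :
  derivable M t v <-> forall i j, derivable (fun x => M x i j : K^o) t v.
Proof.
split=> [/cvg_ex[/= d Md] i j|HM].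
  apply/cvg_ex; exists (d i j).
  have := cvg_comp _ _ Md (@coord_continuous K m n i j d).
  by apply: cvg_trans; apply: near_eq_cvg; near=> x; rewrite /= !mxE.
have dM i j : derivable (fun x => M x i j *: delta_mx i j : 'M[K]_(m, n)) t v.
  have /cvg_ex[/= d Md] := HM i j; apply/cvg_ex; exists (d *: delta_mx i j).
  apply: cvg_trans (cvgZr_tmp (a := delta_mx i j : 'M[K]_(m, n)) Md).
  by apply: near_eq_cvg; near=> x; rewrite /= -scalerBl scalerA.
have -> : M = \sum_i \sum_j (fun x => M x i j *: delta_mx i j).
  apply/funext => x; rewrite [LHS]matrix_sum_delta fct_sumE.
  by apply: eq_bigr => i _; rewrite fct_sumE.
by apply: derivable_sum => i; exact: derivable_sum.
Unshelve. all: by end_near. Qed.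

(** * Closure properties of entire maps *)

Section EntireMaps.
Context {R : realType}.
Implicit Types (h k : R[i] -> R[i]) (F : R[i] -> cquat R).

Lemma entire_cst (c : R[i]) : entire (fun=> c).
Proof. by move=> z; exact: derivable_cst. Qed.

Lemma entireD h k : entire h -> entire k -> entire (fun z => h z + k z).
Proof. by move=> hh hk z; exact: (derivableD (hh z) (hk z)). Qed.

Lemma entireB h k : entire h -> entire k -> entire (fun z => h z - k z).
Proof. by move=> hh hk z; exact: (derivableB (hh z) (hk z)). Qed.

Lemma entireM h k : entire h -> entire k -> entire (fun z => h z * k z).
Proof. by move=> hh hk z; exact: (derivableM (hh z) (hk z)). Qed.

Lemma entire_sum n (h : 'I_n -> R[i] -> R[i]) :
  (forall i, entire (h i)) -> entire (fun z => \sum_(i < n) h i z).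
Proof.
elim: n h => [|n IHn] h hh.
  by under eq_fun do rewrite big_ord0; exact: entire_cst.
under eq_fun do rewrite big_ord_recl.
by apply: entireD => //; exact: IHn.
Qed.

Lemma cquat_entireP F :
  cquat_entire F <-> forall l, entire (fun z => F z 0 l).
Proof.
split=> [HF l z|HF z]; first exact: (derivable_coordP _ _ _).1 (HF z) 0 l.
by apply/derivable_coordP => i l; rewrite ord1; exact: HF.
Qed.

End EntireMaps.

(** * The bilinear form as a matrix product *)

Lemma cdot_mx {K : comPzRingType} (u v : 'rV[K]_4) : u *m v^T = (cdot u v)%:M.
Proof.
apply/rowP => i; rewrite ord1 !mxE eqxx mulr1n.
by apply: eq_bigr => l _; rewrite mxE.
Qed.

Lemma cdotC {K : comPzRingType} (u v : 'rV[K]_4) : cdot u v = cdot v u.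
Proof. by apply: eq_bigr => l _; rewrite mulrC. Qed.

Lemma cdotBB {K : comPzRingType} (u v : 'rV[K]_4) :
  cdot (u - v) (u - v) = cdot u u - 2 * cdot u v + cdot v v.
Proof. by rewrite /cdot !sum_ord4 !mxE; ring. Qed.

Lemma cdot_cquat_of {R : realType} (u v : quat R) :
  cdot (cquat_of u) (cquat_of v) = (qdot u v)%:C.
Proof.
by rewrite /cdot /qdot rmorph_sum; apply: eq_bigr => l _; rewrite !mxE rmorphM.
Qed.

(** * Gram matrix and orthogonal decomposition along the [p_j] and [n] *)

Section Frame.
Context {R : realType} (p : 'I_3 -> quat R) (n : quat R).

Lemma affinely_independent_row_free (a : 'I_4 -> quat R) :
    affinely_independent a -> (forall j, p j = a (lift ord0 j) - a ord0) ->
  row_free (span_mx p).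
Proof.
move=> ha hp; apply: inj_row_free => u uP.
(* A linear relation among the [p_j] becomes an affine one among the [a_i]: the coefficient of [a_0]
   is chosen to make the total zero. *)
pose c (i : 'I_4) := if unlift ord0 i is Some j then u 0 j else - \sum_j u 0 j.
have c0 : c ord0 = - \sum_j u 0 j by rewrite /c unlift_none.
have cS j : c (lift ord0 j) = u 0 j by rewrite /c liftK.
have cE := ha c; apply/rowP => j; rewrite mxE -cS; apply: cE.
  by rewrite big_ord_recl c0; under [X in _ + X]eq_bigr do rewrite cS; rewrite addNr.
rewrite big_ord_recl c0 -[RHS]uP mulmx_sum_row.
under [X in _ + X = _]eq_bigr do rewrite cS.
under [RHS]eq_bigr do rewrite rowK hp scalerBr.
by rewrite sumrB -scaler_suml scaleNr addrC.
Qed.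

Lemma gram_mx : gram p = span_mx p *m (span_mx p)^T.
Proof.
by apply/matrixP => i j; rewrite !mxE; apply: eq_bigr => l _; rewrite !mxE.
Qed.

Hypotheses (p_free : row_free (span_mx p)) (n_normal : unit_normal p n).

(** If [u G = 0], then [|u P|^2 = u G u^T = 0] for [P = span_mx p], so [u P = 0] and [u = 0]. *)
Lemma gram_unit : gram p \in unitmx.
Proof.
rewrite -row_free_unit; apply: inj_row_free => u uG.
apply/(row_free_inj p_free); rewrite mul0mx; apply: qdot_eq0.
have /(congr1 (fun A : 'M[_]_1 => A 0 0)) : (u *m span_mx p) *m (u *m span_mx p)^T = 0.
  by rewrite trmx_mul mulmxA -(mulmxA u) -gram_mx uG mul0mx.
by rewrite cdot_mx !mxE eqxx mulr1n.
Qed.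

Lemma gram_inv_sym : (invmx (gram p))^T = invmx (gram p).
Proof. by rewrite trmx_inv gram_mx trmx_mul trmxK. Qed.

Lemma span_normal : span_mx p *m (n : 'rV_4)^T = 0.
Proof.
have [_ n0] := n_normal; apply/row_matrixP => i; rewrite row_mul row0 cdot_mx cdotC.
by rewrite [cdot _ _](n0 _ (row_sub i _)) raddf0.
Qed.

Lemma frame_resolution :
  (span_mx p)^T *m invmx (gram p) *m span_mx p + (n : 'rV_4)^T *m (n : 'rV_4) = 1%:M.
Proof.
pose M : 'M[R]_(3 + 1, 4) := col_mx (span_mx p) n.
pose N : 'M[R]_(4, 3 + 1) := row_mx ((span_mx p)^T *m invmx (gram p)) (n : 'rV_4)^T.
have MN : M *m N = 1%:M.
  rewrite mul_col_row mulmxA -gram_mx mulmxV ?gram_unit // span_normal.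
  rewrite mulmxA -[(n : 'rV_4) in X in block_mx _ _ X]trmxK -trmx_mul span_normal.
  have [n1 _] := n_normal; rewrite cdot_mx [cdot _ _]n1 trmx0 mul0mx.
  by rewrite -scalar_mx_block.
(* [3 + 1] is convertible to [4], so [M] and [N] are square and a right inverse is a left
   inverse. *)
have : N *m M = 1%:M by exact: (@mulmx1C _ 4 M N MN).
by rewrite mul_row_col.
Qed.

Let Pc := map_mx (real_complex R) (span_mx p).
Let Hc := map_mx (real_complex R) (invmx (gram p)).
Let nc : cquat R := cquat_of n.

Lemma WvecE q : Wvec p q = (bvec p q)^T *m Hc *m Pc.
Proof.
apply/rowP => l; rewrite /Wvec summxE !mxE; apply: eq_bigr => i _.
rewrite summxE !mxE mulr_suml; apply: eq_bigr => k _.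
(* [W] carries the entry [(i, k)] of the inverse Gram matrix, the matrix product the entry [(k, i)];
   symmetry reconciles them. *)
by rewrite -gram_inv_sym !mxE; ring.
Qed.

(** Polarization: half of [<w, w> + |p_i|^2 - <w - p_i, w - p_i>] is [<w, p_i>]. *)
Lemma bvec_cdot q w : (forall i, q (lift ord0 i) =
      cdot (w - cquat_of (p i)) (w - cquat_of (p i))) ->
  q ord0 = cdot w w -> bvec p q = Pc *m w^T.
Proof.
move=> qS q0; apply/colP => i; rewrite !mxE q0 qS cdotBB cdot_cquat_of.
rewrite (_ : \sum_j _ = cdot w (cquat_of (p i))); first by field.
by rewrite cdotC; apply: eq_bigr => l _; rewrite !mxE.
Qed.

Lemma cdot_frame (w : cquat R) : w = (w *m Pc^T) *m Hc *m Pc + cdot w nc *: nc.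
Proof.
have /(congr1 (map_mx (real_complex R))) := frame_resolution.
rewrite map_mxD !map_mxM -!map_trmx map_mx1 -/Pc -/Hc => F1.
rewrite -mul_scalar_mx -cdot_mx -!mulmxA -mulmxDr.
by rewrite mulmxA F1 mulmx1.
Qed.

Lemma cdot_frame_sqr (w : cquat R) :
  cdot w w = ((w *m Pc^T) *m Hc *m (Pc *m w^T)) 0 0 + cdot w nc ^+ 2.
Proof.
have /(congr1 (fun A : 'M[_]_1 => A 0 0)) := cdot_mx w w.
(* Only the left factor [w] is decomposed; the right one is then paired with each component. *)
rewrite [RHS]mxE eqxx mulr1n => <-; rewrite [X in (X *m w^T) 0 0 = _]cdot_frame.
rewrite mulmxDl -scalemxAl [nc *m _]cdot_mx scale_scalar_mx cdotC.
by rewrite [LHS]mxE [X in _ + X]mxE eqxx mulr1n -expr2 !mulmxA.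
Qed.

Lemma frame_of_dots q w :
    (forall i, q (lift ord0 i) = cdot (w - cquat_of (p i)) (w - cquat_of (p i))) ->
    q ord0 = cdot w w ->
  w = Wvec p q + cdot w nc *: nc /\ DeltaA p q = cdot w nc ^+ 2.
Proof.
move=> qS q0; have bE := bvec_cdot _ _ qS q0.
rewrite WvecE /DeltaA bE trmx_mul trmxK -cdot_frame; split=> //.
by rewrite q0 cdot_frame_sqr addrC addKr.
Qed.

(** Orthogonality of [n] to the [p_j] lets one recover [b(Q)] and [t] by pairing [w] with the [p_j]
    and with [n]. Then [cdot_frame_sqr] gives [Q_0], and polarization read backwards gives the other
    [Q_j]. *)
Lemma dots_of_frame q t (w : cquat R) :
    w = Wvec p q + t *: nc -> DeltaA p q = t ^+ 2 ->
  cdot w w = q ord0 /\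
  forall i, cdot (w - cquat_of (p i)) (w - cquat_of (p i)) = q (lift ord0 i).
Proof.
have Pn : Pc *m nc^T = 0.
  by rewrite [nc^T]map_trmx -map_mxM span_normal map_mx0.
have nn : cdot nc nc = 1.
  by rewrite cdot_cquat_of (n_normal.1) rmorph1.
have PH : Hc *m (Pc *m Pc^T) = 1%:M.
  by rewrite [Pc^T]map_trmx -!map_mxM -gram_mx mulVmx ?gram_unit // map_mx1.
have nP : nc *m Pc^T = 0 by rewrite -[nc]trmxK -trmx_mul Pn trmx0.
move=> wE Dt.
have wP : w *m Pc^T = (bvec p q)^T.
  by rewrite wE WvecE mulmxDl -scalemxAl nP scaler0 addr0 -!mulmxA PH mulmx1.
have wn : cdot w nc = t.
  have /(congr1 (fun A : 'M[_]_1 => A 0 0)) := cdot_mx w nc.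
  rewrite [RHS]mxE eqxx mulr1n => <-.
  rewrite wE WvecE mulmxDl -scalemxAl [nc *m _]cdot_mx nn -!mulmxA Pn !mulmx0 add0r.
  by rewrite !mxE eqxx mulr1n mulr1.
have Pw : Pc *m w^T = bvec p q.
  by rewrite -[Pc]trmxK -trmx_mul wP trmxK.
have ww : cdot w w = q ord0.
  by rewrite cdot_frame_sqr wP Pw wn -Dt /DeltaA addrC subrK.
split=> // i; rewrite cdotBB ww cdot_cquat_of.
have /colP/(_ i) := Pw; rewrite [RHS]mxE [LHS]mxE.
rewrite (_ : \sum_j _ = cdot w (cquat_of (p i))).
  by move=> ->; field.
by rewrite cdotC; apply: eq_bigr => l _; rewrite !mxE.
Qed.

End Frame.

(** * Conjugation symmetry and entireness of the constructed functions *)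

Lemma cdot_conj {R : realType} (u v : cquat R) :
  cdot (cqconj u) (cqconj v) = conjc (cdot u v).
Proof.
by rewrite /cdot rmorph_sum; apply: eq_bigr => l _; rewrite !mxE rmorphM.
Qed.

Lemma cqconj_of {R : realType} (u : quat R) : cqconj (cquat_of u) = cquat_of u.
Proof. by apply/rowP => l; rewrite !mxE /= oppr0. Qed.

Lemma cqconjB {R : realType} (u v : cquat R) : cqconj (u - v) = cqconj u - cqconj v.
Proof. exact: map_mxB. Qed.

Lemma cqconjD {R : realType} (u v : cquat R) : cqconj (u + v) = cqconj u + cqconj v.
Proof. exact: map_mxD. Qed.

Lemma cqconjZ {R : realType} c (u : cquat R) : cqconj (c *: u) = conjc c *: cqconj u.
Proof. exact: map_mxZ. Qed.

Lemma cquat_ofB {R : realType} (u v : quat R) :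
  cquat_of (u - v) = cquat_of u - cquat_of v.
Proof. exact: map_mxB. Qed.

Lemma Wvec_conj {R : realType} (p : 'I_3 -> quat R) q :
  Wvec p (fun j => conjc (q j)) = cqconj (Wvec p q).
Proof.
have bE i : bvec p (fun j => conjc (q j)) i 0 = conjc (bvec p q i 0).
  have half_conj : conjc (2^-1 : R[i]) = 2^-1 by rewrite conjc_inv conjc_nat.
  (* The real constants are abstracted, keeping only that conjugation fixes them. *)
  rewrite !mxE; move: 2^-1 half_conj => h hE.
  have := conjc_real (qdot (p i) (p i)); move: _%:C => c cE.
  by rewrite rmorphM rmorphB rmorphD /= cE hE.
rewrite /Wvec [RHS]raddf_sum; apply: eq_bigr => i _.
rewrite raddf_sum; apply: eq_bigr => k _ /=.
by rewrite bE -[RHS]/(cqconj _) cqconjZ cqconj_of rmorphM /= oppr0.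
Qed.

Lemma cdot_entire {R : realType} (F H : R[i] -> cquat R) :
  cquat_entire F -> cquat_entire H -> entire (fun z => cdot (F z) (H z)).
Proof.
move=> /cquat_entireP HF /cquat_entireP HH; apply: entire_sum => l.
exact: entireM.
Qed.

Lemma cquat_entire_cst {R : realType} (w : cquat R) : cquat_entire (fun=> w).
Proof. by apply/cquat_entireP => l; exact: entire_cst. Qed.

Lemma cquat_entireB {R : realType} (F H : R[i] -> cquat R) :
  cquat_entire F -> cquat_entire H -> cquat_entire (fun z => F z - H z).
Proof.
move=> /cquat_entireP HF /cquat_entireP HH; apply/cquat_entireP => l.
by under eq_fun do rewrite mxE [X in _ + X]mxE; exact: entireB.
Qed.

Lemma Wvec_entire {R : realType} (p : 'I_3 -> quat R) (Q : 'I_4 -> R[i] -> R[i]) :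
  (forall j, entire (Q j)) -> cquat_entire (fun z => Wvec p (Q ^~ z)).
Proof.
move=> HQ; apply/cquat_entireP => l.
under eq_fun do rewrite summxE; apply: entire_sum => i.
under eq_fun do rewrite summxE; apply: entire_sum => k.
under eq_fun do rewrite !mxE.
apply: entireM; last exact: entire_cst.
apply: entireM; first exact: entire_cst.
apply: entireM; first exact: entire_cst.
apply: entireB; last exact: HQ.
by apply: entireD; [exact: HQ | exact: entire_cst].
Qed.

Theorem theorem3p7 (R : realType) (a : 'I_4 -> quat R)
    (ha : affinely_independent a)
    (p : 'I_3 -> quat R) (hp : forall j, p j = a (lift ord0 j) - a ord0)
    (n : quat R) (hn : unit_normal p n) :
  (exists f : quat R -> quat R,
     [/\ entire_slice_regular f,
         nonconstant f
       & forall (j : 'I_4) (q : quat R), f q <> a j])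
  <->
  (exists (Q : 'I_4 -> R[i] -> R[i]) (tau : R[i] -> R[i]),
     [/\ forall j, [/\ entire (Q j), real_symmetric (Q j) & zero_free (Q j)],
         entire tau /\ real_symmetric tau,
         forall z, DeltaA p (Q ^~ z) = tau z ^+ 2
       & nonconstant (fun z => Wvec p (Q ^~ z) + tau z *: cquat_of n)]).
Proof.
have p_free := affinely_independent_row_free p a ha hp.
(* Translation by [a_0] turns the remaining omitted points into the [p_j]. *)
have shiftE j w : w - cquat_of (a (lift ord0 j)) =
    w - cquat_of (a ord0) - cquat_of (p j).
  by rewrite hp cquat_ofB opprB addrA subrK.
split=> [[f [[F [Fent Fsym] Ff] fnc fa]]|[Q [tau [HQ [tauent tausym] HD Wnc]]]].
  pose F0 z := F z - cquat_of (a ord0).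
  have FBent c : cquat_entire (fun z => F z - cquat_of c).
    exact: cquat_entireB F _ Fent (cquat_entire_cst (cquat_of c)).
  have F0sym z : F0 (conjc z) = cqconj (F0 z).
    by rewrite /F0 Fsym cqconjB cqconj_of.
  pose Q j z := cdot (F z - cquat_of (a j)) (F z - cquat_of (a j)).
  pose tau z := cdot (F0 z) (cquat_of n).
  have frame z : F0 z = Wvec p (Q ^~ z) + tau z *: cquat_of n /\
      DeltaA p (Q ^~ z) = tau z ^+ 2.
    by apply: frame_of_dots => // i; rewrite /Q shiftE.
  exists Q, tau; split.
  - move=> j; split.
    + exact: cdot_entire _ _ (FBent (a j)) (FBent (a j)).
    + move=> z; rewrite /Q Fsym -[cquat_of (a j)]cqconj_of -cqconjB cdot_conj.
      by rewrite cqconj_of.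
    + exact/(induces_omits (a j) Ff).
  - split.
      exact: cdot_entire _ _ (FBent (a ord0)) (cquat_entire_cst (cquat_of n)).
    by move=> z; rewrite /tau F0sym -[cquat_of n]cqconj_of cdot_conj cqconj_of.
  - by move=> z; have [] := frame z.
  (* By [frame], the stem [W(Q) + tau n] is [F] shifted by the constant [a_0]. *)
  - have [z [z' zz']] := (induces_nonconstant Fsym Ff).1 fnc.
    exists z, z'; have [<- _] := frame z; have [<- _] := frame z'.
    by move=> /addIr.
pose F0 z := Wvec p (Q ^~ z) + tau z *: cquat_of n.
(* Adding [a_0] back undoes the normalization [p_0 = 0]. *)
pose F z := F0 z + cquat_of (a ord0).
have F0sym z : F0 (conjc z) = cqconj (F0 z).
  rewrite /F0 cqconjD cqconjZ cqconj_of -Wvec_conj tausym; congr (Wvec _ _ + _).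
  by apply/funext => j; have [_ -> _] := HQ j.
have Fsym z : F (conjc z) = cqconj (F z).
  by rewrite /F F0sym cqconjD cqconj_of.
have Fent : cquat_entire F.
  have /cquat_entireP Went : cquat_entire (fun z => Wvec p (Q ^~ z)).
    by apply: Wvec_entire => j; have [] := HQ j.
  apply/cquat_entireP => l.
  have -> : (fun z => F z 0 l) = (fun z => Wvec p (Q ^~ z) 0 l +
      tau z * cquat_of n 0 l + cquat_of (a ord0) 0 l).
    by apply/funext => z; rewrite mxE [X in X + _]mxE [X in _ + X + _]mxE.
  apply: entireD (entire_cst _); apply: entireD (Went l) _.
  exact: entireM tauent (entire_cst _).
have [f Ff] := induces_exists _ Fsym.
exists f; split; first by exists F.
  apply/(induces_nonconstant Fsym Ff); have [z [z' zz']] := Wnc.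
  by exists z, z' => /addIr.
have FK z : F z - cquat_of (a ord0) = F0 z by rewrite addrK.
move=> j; apply/(induces_omits (a j) Ff) => z.
have [_ _ /(_ z)] := HQ j.
(* The products of [F - a_j] with itself are exactly the zero-free [Q_j]. *)
have [d0 dS] := dots_of_frame p n p_free hn (Q ^~ z) (tau z) _ (erefl (F0 z)) (HD z).
case: (unliftP ord0 j) => [i|] ->; last by rewrite FK d0.
by rewrite shiftE FK dS.
Qed.
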